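(* Let $\nu$ be a weight in $\mathbb R^{n+1}$ and let $\Psi:\mathcal K(\nu)\to A(\nu)$ be the bijection sending a Kostant picture with $c_{ij}$ copies of loop $[i,j]$ to the Lusztig datum $(c_{11},c_{12},\dots,c_{1n},c_{22},\dots,c_{2n},\dots,c_{nn})$. Then the two-sided dictionary order on $A(\nu)$ is a refinement of the merge order on $\mathcal K(\nu)$: if $P\le Q$ in the merge order, then $\Psi(P)\le\Psi(Q)$ in the two-sided dictionary order. The converse does not hold in general; for example, for $\nu=(1,1,-1,-1)$ there are pictures $P,Q$ with $\Psi(P)\le\Psi(Q)$ but $P\not\le Q$ in the merge order.
   Context: Let $e_1,\dots,e_{n+1}$ be the standard basis of $\mathbb R^{n+1}$ and $\alpha_{ij}=e_i-e_{j+1}$ for $1\le i\le j\le n$. A weight is $\nu=\sum c_{ij}\alpha_{ij}$ with $c_{ij}\in\mathbb N$. A Lusztig datum for $\nu$ is a tuple $\mathbf a=(a_{11},a_{12},\dots,a_{1n},a_{22},\dots,a_{2n},\dots,a_{nn})\in\mathbb N^{\binom{n+1}{2}}$ (in this fixed order, indexed linearly by $1,\dots,\binom{n+1}{2}$) with $\sum a_{ij}\alpha_{ij}=\nu$; $A(\nu)$ is the set of these. The two-sided dictionary order on $A(\nu)$: $\mathbf a\le\mathbf a'$ if there exist indices $l\le r$ (in the linear indexing) with $a'_l>a_l$, $a'_r>a_r$, and $a'_i=a_i$ for all $i<l$ and all $i>r$. A Kostant picture for $\nu$ is a decomposition $\nu=\sum c_{ij}\alpha_{ij}$, $c_{ij}\in\mathbb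 N$, viewed as a multiset of loops (intervals) $[i,j]$ on vertices $1,\dots,n$ with $c_{ij}$ copies of $[i,j]$; $\mathcal K(\nu)$ is the set of these. The merge order on $\mathcal K(\nu)$: $P$ is covered by $Q$ iff $P$ is obtained from $Q$ by merging two of its loops into one, i.e. replacing loops $[i,j]$ and $[j+1,k]$ of $Q$ by the single loop $[i,k]$; the order is the reflexive-transitive closure of this relation. *)

(* Defs.v *)
From Stdlib Require Import Relation_Operators.
From mathcomp Require Import all_boot all_order all_algebra.
From mathcomp Require Import finmap multiset.
From mathcomp Require Import reals.

Set Implicit Arguments.
Unset Strict Implicit.
Unset Printing Implicit Defensive.

Import GRing.Theory.
Local Open Scope mset_scope.
Local Open Scope ring_scope.

(* Indices start at 0: the vertices 1, ..., n are the elements of 'I_n and the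
   basis vectors e_1, ..., e_(n+1) of R^(n+1) are the delta_mx 0 k, k : 'I_n.+1. *)
Definition loop (n : nat) := {p : 'I_n * 'I_n | (p.1 <= p.2)%N}.

Section Loops.
Variable n : nat.

Definition lo (x : loop n) : 'I_n := (val x).1.
Definition hi (x : loop n) : 'I_n := (val x).2.

(* [1,1], [1,2], ..., [1,n], [2,2], ..., [2,n], ..., [n,n] *)
Definition loop_seq : seq (loop n) :=
  pmap insub [seq (i, j) | i <- enum 'I_n, j <- enum 'I_n].

Lemma loop_seq_uniq : uniq loop_seq.
Proof.
by apply: pmap_sub_uniq; apply: allpairs_uniq; rewrite ?enum_uniq //; case=> [? ?] [].
Qed.

Lemma mem_loop_seq (x : loop n) : x \in loop_seq.
Proof.
rewrite mem_pmap_sub; apply/allpairsP; exists (val x).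
by rewrite !mem_enum -surjective_pairing.
Qed.

Lemma size_loop_seq : size loop_seq == 'C(n.+1, 2).
Proof.
have le_count (i : 'I_n) : \sum_(j < n | (i <= j)%N) 1%N = (n - i)%N.
  by rewrite -(big_geq_mkord _ n xpredT (fun=> 1%N)) sum_nat_const_nat muln1.
rewrite size_pmap_sub count_flatten sumnE -map_comp big_map big_enum /=.
rewrite -bin2_sum big_nat_recl // add0n big_mkord (reindex_inj rev_ord_inj) /=.
apply/eqP/eq_bigr => i _; rewrite count_map -sum1_count big_enum_cond /=.
by rewrite (le_count (rev_ord i)) /= subKn.
Qed.

Definition loops : 'C(n.+1, 2).-tuple (loop n) := Tuple size_loop_seq.

(* merge1 P Q: P arises from Q by replacing loops x = [i,j] and y = [j+1,k] of Q
   with z = [i,k]; M collects the loops left untouched. *)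
Variant merge1 : {mset loop n} -> {mset loop n} -> Prop :=
  Merge1 (x y z : loop n) (M : {mset loop n}) of
    lo y = (hi x).+1 :> nat & lo z = lo x & hi z = hi y :
    merge1 (z +` M) ([mset x; y] `+` M).

End Loops.

Section Weights.
Variables (R : realType) (n : nat).

Definition alpha (x : loop n) : 'rV[R]_n.+1 :=
  delta_mx 0 (widen_ord (leqnSn n) (lo x)) - delta_mx 0 (lift ord0 (hi x)).

Definition is_weight (nu : 'rV[R]_n.+1) : Prop :=
  exists c : loop n -> nat, nu = \sum_x alpha x *+ c x.

Definition multiplicities (P : {mset loop n}) : 'C(n.+1, 2).-tuple nat :=
  [tuple P (tnth (loops n) k) | k < 'C(n.+1, 2)].

Lemma multiplicities_weight (P : {mset loop n}) :
  \sum_(k < 'C(n.+1, 2)) alpha (tnth (loops n) k) *+ tnth (multiplicities P) k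
  = \sum_x alpha x *+ P x.
Proof.
rewrite (eq_bigr (fun k => alpha (tnth (loops n) k) *+ P (tnth (loops n) k)));
  last by move=> k _; rewrite tnth_mktuple.
rewrite -(big_tuple _ _ (loops n) xpredT (fun x => alpha x *+ P x)).
rewrite [RHS](perm_big (loops n)) //=.
apply: uniq_perm; rewrite ?index_enum_uniq ?loop_seq_uniq // => x.
by rewrite mem_index_enum mem_loop_seq.
Qed.

Variable nu : 'rV[R]_n.+1.

Definition kostant := {P : {mset loop n} | \sum_x alpha x *+ P x == nu}.

Definition lusztig :=
  {a : 'C(n.+1, 2).-tuple nat |
    \sum_(k < 'C(n.+1, 2)) alpha (tnth (loops n) k) *+ tnth a k == nu}.

Definition merge_le : kostant -> kostant -> Prop :=
  clos_refl_trans kostant (fun P Q => merge1 (val P) (val Q)).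

Definition dict_lt (a a' : lusztig) : Prop :=
  exists l r : 'I_('C(n.+1, 2)),
    [/\ (l <= r)%N,
        (tnth (val a) l < tnth (val a') l)%N,
        (tnth (val a) r < tnth (val a') r)%N &
        forall i : 'I_('C(n.+1, 2)),
          (i < l)%N || (r < i)%N -> tnth (val a') i = tnth (val a) i].

(* dict_lt is never reflexive; its reflexive closure is the order. *)
Definition dict_le (a a' : lusztig) : Prop := a = a' \/ dict_lt a a'.

Lemma Psi_subproof (P : kostant) :
  \sum_(k < 'C(n.+1, 2))
    alpha (tnth (loops n) k) *+ tnth (multiplicities (val P)) k == nu.
Proof. by rewrite multiplicities_weight (valP P). Qed.

Definition Psi (P : kostant) : lusztig :=
  exist _ (multiplicities (val P)) (Psi_subproof P).

End Weights.

(* Main.v *)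
(* Merging [i,j] and [j+1,k] into [i,k] lowers the multiplicities of [i,j] and
   of [j+1,k], and raises only that of [i,k]. Since the list of loops is
   lexicographic, [i,k] lies strictly between the other two, so [i,j] and
   [j+1,k] are the outermost places where the data change. The converse fails: a
   merge strictly decreases the number of loops, so two distinct pictures with
   two loops each are incomparable, while {[1,3],[2,2]} precedes {[1,2],[2,3]}
   in the dictionary order. *)

Require Import Defs.
From mathcomp Require Import all_boot all_order all_algebra.
From mathcomp Require Import finmap multiset.
From mathcomp Require Import reals.

Import GRing.Theory.
Local Open Scope mset_scope.
Local Open Scope ring_scope.

(** * Lexicographic order of the loops and their positions *)

Definition lex {n : nat} : rel ('I_n * 'I_n) :=
  fun p q => (p.1 < q.1)%N || (p.1 == q.1) && (p.2 < q.2)%N.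

Lemma lex_irr n : irreflexive (@lex n).
Proof. by move=> p; rewrite /lex !ltnn andbF. Qed.

Lemma lex_trans n : transitive (@lex n).
Proof.
move=> q p r; rewrite /lex => /orP[pq|/andP[/eqP-> pq]] /orP[qr|/andP[/eqP<- qr]].
- by rewrite (ltn_trans pq qr).
- by rewrite pq.
- by rewrite qr.
- by rewrite eqxx (ltn_trans pq qr) orbT.
Qed.

Lemma pairwise_ltn_enum_ord n : pairwise (relpre val ltn) (enum 'I_n).
Proof.
by rewrite -pairwise_map val_enum_ord -(sorted_pairwise ltn_trans) iota_ltn_sorted.
Qed.

Lemma pairwise_lex_allpairs n (s t : seq 'I_n) :
  pairwise (relpre val ltn) s -> pairwise (relpre val ltn) t ->
  pairwise lex [seq (i, j) | i <- s, j <- t].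
Proof.
move=> + lt_t; elim: s => // i s IHs /andP[/allP lt_s /IHs IH].
(* The block of pairs starting with [i] is ordered by the second coordinate, and precedes all later
   blocks by the first. *)
rewrite allpairs_cons pairwise_cat IH andbT; apply/andP; split; last first.
  rewrite pairwise_map; apply: sub_pairwise lt_t => j k /= lt_jk.
  by rewrite /lex /= eqxx lt_jk orbT.
apply/allrelP => p q /mapP[j _ ->] /allpairsP[[k m] /= [/lt_s lt_ik _ ->]].
by rewrite /lex [X in X || _]lt_ik.
Qed.

Lemma sorted_loop_seq n : sorted (relpre val lex) (loop_seq n).
Proof.
(* Under [val], [pmap insub] becomes a filter, and filtering preserves sortedness for a transitive
   relation. *)
rewrite -sorted_map (pmap_filter (insubK _)).
apply: sorted_filter; first exact: lex_trans.
rewrite (sorted_pairwise (@lex_trans n)).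
by apply: pairwise_lex_allpairs; exact: pairwise_ltn_enum_ord.
Qed.

Definition pos {n : nat} (x : loop n) : 'I_('C(n.+1, 2)) :=
  cast_ord (eqP (size_loop_seq n))
    (Ordinal (etrans (index_mem x (loop_seq n)) (mem_loop_seq x))).

Lemma tnth_pos n (x : loop n) : tnth (loops n) (pos x) = x.
Proof. by rewrite (tnth_nth x) nth_index // mem_loop_seq. Qed.

Lemma pos_tnth n (k : 'I_('C(n.+1, 2))) : pos (tnth (loops n) k) = k.
Proof.
apply: val_inj; rewrite /= (tnth_nth (tnth (loops n) k)).
by rewrite index_uniq ?loop_seq_uniq // (eqP (size_loop_seq n)).
Qed.

Lemma pos_ltn_lex n (x y : loop n) : (pos x < pos y)%N -> lex (val x) (val y).
Proof.
apply: (sorted_ltn_index _ (sorted_loop_seq n)); rewrite ?mem_loop_seq //.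
by move=> ? ? ?; apply: lex_trans.
Qed.

Lemma tnth_Psi {R : realType} {n : nat} {nu : 'rV[R]_n.+1} (P : kostant nu) k :
  tnth (val (Psi P)) k = val P (tnth (loops n) k).
Proof. by rewrite tnth_mktuple. Qed.

(** * Bijectivity of [Psi] *)

(** The finite domain contains every loop, so the default multiplicity 0 is never taken. *)
Definition mset_of_multiplicities {n : nat} (a : 'C(n.+1, 2).-tuple nat) :
    {mset loop n} :=
  [fsfun x in [fset x in loop_seq n]%fset => tnth a (pos x)].

Lemma mset_of_multiplicitiesE n (a : 'C(n.+1, 2).-tuple nat) (x : loop n) :
  mset_of_multiplicities a x = tnth a (pos x).
Proof. by rewrite fsfun_fun !inE /= mem_loop_seq. Qed.

Lemma mset_of_multiplicitiesK n :
  cancel (@mset_of_multiplicities n) (@multiplicities n).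
Proof.
move=> a; apply: eq_from_tnth => k.
by rewrite tnth_mktuple mset_of_multiplicitiesE pos_tnth.
Qed.

Lemma multiplicitiesK n : cancel (@multiplicities n) (@mset_of_multiplicities n).
Proof.
move=> P; apply/msetP => x.
by rewrite mset_of_multiplicitiesE tnth_mktuple tnth_pos.
Qed.

Lemma Psi_bij (R : realType) (n : nat) (nu : 'rV[R]_n.+1) :
  bijective (@Psi R n nu).
Proof.
have weightE (a : lusztig nu) :
    \sum_x alpha R x *+ mset_of_multiplicities (val a) x == nu.
  by rewrite -multiplicities_weight mset_of_multiplicitiesK (valP a).
pose Phi (a : lusztig nu) : kostant nu :=
  exist _ (mset_of_multiplicities (val a)) (weightE a).
exists Phi => [P|a]; apply: val_inj.
  exact: multiplicitiesK.
exact: mset_of_multiplicitiesK.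
Qed.

(** * Merging and the two-sided dictionary order *)

(** The smaller of [l], [l'] and the larger of [r], [r'] are witnesses. At each of them one
    comparison is strict and the other is strict or an equality; beyond them all three data
    agree. *)
Lemma dict_lt_trans (R : realType) (n : nat) (nu : 'rV[R]_n.+1)
    (a b c : lusztig nu) :
  dict_lt a b -> dict_lt b c -> dict_lt a c.
Proof.
move=> [l [r [lr al ar out]]] [l' [r' [lr' bl br out']]].
have [m [leml leml' ltm]] : exists m : 'I_('C(n.+1, 2)),
    [/\ (m <= l)%N, (m <= l')%N & (tnth (val a) m < tnth (val c) m)%N].
  case: (ltngtP l l') => [ll'|l'l|/val_inj ll'].
  - by exists l; rewrite leqnn (ltnW ll') out' ?ll'.
  - by exists l'; rewrite leqnn (ltnW l'l) -out ?l'l.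
  - by exists l; rewrite -ll' leqnn (ltn_trans al) // ll'.
have [m' [gem gem' ltm']] : exists m : 'I_('C(n.+1, 2)),
    [/\ (r <= m)%N, (r' <= m)%N & (tnth (val a) m < tnth (val c) m)%N].
  case: (ltngtP r r') => [rr'|r'r|/val_inj rr'].
  - by exists r'; rewrite leqnn (ltnW rr') -out ?rr' ?orbT.
  - by exists r; rewrite leqnn (ltnW r'r) out' ?r'r ?orbT.
  - by exists r; rewrite -rr' leqnn (ltn_trans ar) // rr'.
exists m, m'; split => //; first exact: leq_trans leml (leq_trans lr gem).
move=> i /orP[im|im]; rewrite out' ?out //.
- by rewrite (leq_trans im leml).
- by rewrite (leq_trans im leml').
- by rewrite (leq_ltn_trans gem im) orbT.
- by rewrite (leq_ltn_trans gem' im) orbT.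
Qed.

(** Lets data be compared through the endpoints of loops, without computing positions. *)
Lemma dict_lt_Psi (R : realType) (n : nat) (nu : 'rV[R]_n.+1)
    (P Q : kostant nu) (x y : loop n) :
  lex (val x) (val y) -> (val P x < val Q x)%N -> (val P y < val Q y)%N ->
  (forall w, lex (val w) (val x) || lex (val y) (val w) -> val Q w = val P w) ->
  dict_lt (Psi P) (Psi Q).
Proof.
move=> xy Px Py out; exists (pos x), (pos y); rewrite !tnth_Psi !tnth_pos.
split=> // [|k k_out].
  rewrite leqNgt; apply/negP => /pos_ltn_lex /(lex_trans _ _ _ _ xy).
  by rewrite lex_irr.
rewrite !tnth_Psi; apply: out.
by case/orP: k_out => H; apply/orP; [left|right];
   apply: pos_ltn_lex; rewrite pos_tnth.
Qed.

Lemma merge1_dict_lt (R : realType) (n : nat) (nu : 'rV[R]_n.+1)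
    (P Q : kostant nu) :
  merge1 (val P) (val Q) -> dict_lt (Psi P) (Psi Q).
Proof.
(* The indices of [merge1] must be variables before the case analysis. *)
move EP: (val P) => p; move EQ: (val Q) => q m.
case: m EP EQ => x y z M loy loz hiz EP EQ.
have lexne (u v : loop n) : lex (val u) (val v) -> u != v.
  by apply: contraTneq => ->; rewrite lex_irr.
have xy_hi : (hi x < lo y)%N by rewrite loy.
(* Same first vertex, and [hi x < lo y <= hi y = hi z]. *)
have xz : lex (val x) (val z).
  apply/orP; right; move: loz hiz (valP y); rewrite /lo /hi => -> -> le_y.
  by rewrite eqxx; apply: leq_trans le_y.
(* Here [lo z = lo x <= hi x < lo y]. *)
have zy : lex (val z) (val y).
  apply/orP; left; move: loz (valP x); rewrite /lo => -> le_x.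
  exact: leq_ltn_trans xy_hi.
have xy := lex_trans _ _ _ _ xz zy.
have [[nxz nzy] nxy] := (lexne _ _ xz, lexne _ _ zy, lexne _ _ xy).
apply: (dict_lt_Psi _ _ _ _ _ _ _ xy); rewrite EP EQ.
- by rewrite !msetE2 !msetnE eqxx (negPf nxz) (negPf nxy).
- by rewrite !msetE2 !msetnE eqxx eq_sym (negPf nzy) eq_sym (negPf nxy).
(* Such a [w] differs from [x], [y] and [z], so both multiplicities are that of [M]. *)
- move=> w /orP[wx|yw].
  + rewrite !msetE2 !msetnE (negPf (lexne _ _ wx)).
    rewrite (negPf (lexne _ _ (lex_trans _ _ _ _ wx xz))).
    by rewrite (negPf (lexne _ _ (lex_trans _ _ _ _ wx xy))).
  + rewrite !msetE2 !msetnE ![w == _]eq_sym (negPf (lexne _ _ yw)).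
    rewrite (negPf (lexne _ _ (lex_trans _ _ _ _ zy yw))).
    by rewrite (negPf (lexne _ _ (lex_trans _ _ _ _ xy yw))).
Qed.

(** * Counting loops and the counterexample *)

Lemma sum_mulrn_msetD (V : nmodType) n (F : loop n -> V) (A B : {mset loop n}) :
  \sum_x F x *+ (A `+` B) x = \sum_x F x *+ A x + \sum_x F x *+ B x.
Proof. by rewrite -big_split; apply: eq_bigr => x _; rewrite msetE2 mulrnDr. Qed.

Lemma sum_mulrn_mset1 (V : nmodType) n (F : loop n -> V) (a : loop n) :
  \sum_x F x *+ [mset a] x = F a.
Proof.
rewrite (bigD1 a) //= msetnxx big1 ?addr0 // => x /negPf xa.
by rewrite msetnE xa.
Qed.

Lemma sum_mulrn_mset2 (V : nmodType) n (F : loop n -> V) (a b : loop n) :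
  \sum_x F x *+ [mset a; b] x = F a + F b.
Proof.
by rewrite sum_mulrn_msetD; congr (_ + _); apply: sum_mulrn_mset1.
Qed.

Definition loop_count {n : nat} (P : {mset loop n}) : nat := (\sum_x P x)%N.

Lemma loop_count_msetD n (A B : {mset loop n}) :
  loop_count (A `+` B) = (loop_count A + loop_count B)%N.
Proof. by rewrite /loop_count -big_split; apply: eq_bigr => x _; rewrite msetE2. Qed.

Lemma loop_count_mset1 n (a : loop n) : loop_count [mset a] = 1%N.
Proof.
rewrite /loop_count (bigD1 a) //= msetnxx big1 // => x /negPf xa.
by rewrite msetnE xa.
Qed.

Lemma merge1_loop_count n (P Q : {mset loop n}) :
  merge1 P Q -> loop_count Q = (loop_count P).+1.
Proof. by case=> x y z M _ _ _; rewrite !loop_count_msetD !loop_count_mset1. Qed.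

Lemma merge_le_loop_count (R : realType) n (nu : 'rV[R]_n.+1) (P Q : kostant nu) :
  merge_le P Q -> P = Q \/ (loop_count (val P) < loop_count (val Q))%N.
Proof.
elim=> {P Q} [P Q /merge1_loop_count ->|P|P Q T _ [->|PQ] _ [<-|QT]]; auto.
by right; apply: ltn_trans QT.
Qed.

(* Indices are 0-based: this is the loop [i+1, j+1] of the text. *)
Definition loop3 (i j : nat) (i3 : (i < 3)%N) (j3 : (j < 3)%N) (ij : (i <= j)%N) :
  loop 3 := exist _ (Ordinal i3, Ordinal j3) ij.

Lemma dict_le_not_merge_le (R : realType) :
  let nu : 'rV[R]_4 := \row_(i < 4) [:: 1; 1; -1; -1]`_i in
  exists P Q : @kostant R 3 nu, dict_le (Psi P) (Psi Q) /\ ~ merge_le P Q.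
Proof.
move=> nu.
pose l12 := loop3 0 1 isT isT isT; pose l23 := loop3 1 2 isT isT isT.
pose l13 := loop3 0 2 isT isT isT; pose l2 := loop3 1 1 isT isT isT.
(* Both sums are e_1 + e_2 - e_3 - e_4: (e_1 - e_4) + (e_2 - e_3) here, (e_1 - e_3) + (e_2 - e_4)
   for [Q]. *)
have weightP : \sum_x alpha R x *+ [mset l13; l2] x == nu.
  rewrite (sum_mulrn_mset2 _ _ (@alpha R 3)); apply/eqP/rowP => i.
  rewrite !mxE -!val_eqE /=.
  by case: i => [[|[|[|[|//]]]] ?] /=; rewrite ?subr0 ?sub0r ?addr0 ?add0r.
have weightQ : \sum_x alpha R x *+ [mset l12; l23] x == nu.
  rewrite (sum_mulrn_mset2 _ _ (@alpha R 3)); apply/eqP/rowP => i.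
  rewrite !mxE -!val_eqE /=.
  by case: i => [[|[|[|[|//]]]] ?] /=; rewrite ?subr0 ?sub0r ?addr0 ?add0r.
pose P : kostant nu := exist _ [mset l13; l2] weightP.
pose Q : kostant nu := exist _ [mset l12; l23] weightQ.
have PE w : val P w = ((w == l13) + (w == l2))%N.
  by rewrite mset1DE msetnE; case: eqP.
have QE w : val Q w = ((w == l12) + (w == l23))%N.
  by rewrite mset1DE msetnE; case: eqP.
have count_eq : loop_count (val P) = loop_count (val Q).
  by rewrite [LHS]loop_count_msetD [RHS]loop_count_msetD 4!loop_count_mset1.
clearbody P Q; exists P, Q; split.
  right; apply: (@dict_lt_Psi _ _ _ P Q l12 l23 isT).
  - by rewrite PE QE.
  - by rewrite PE QE.
  (* All four loops lie between [l12] and [l23], so outside both multiplicities are 0; the finitely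
     many loops are checked in turn. *)
  - move=> w; rewrite PE QE -!val_eqE /=.
    by case: w => [[[[|[|[|//]]] ?] [[|[|[|//]]] ?]] ?].
move/merge_le_loop_count => [PQ|].
  (* [l12] occurs once in [Q] and not in [P]. *)
  by have := QE l12; rewrite -PQ PE.
by rewrite count_eq ltnn.
Qed.

Theorem theorem3p6 (R : realType) :
  (forall (n : nat) (nu : 'rV[R]_n.+1), is_weight nu ->
     bijective (@Psi R n nu) /\
     forall P Q : kostant nu, merge_le P Q -> dict_le (Psi P) (Psi Q)) /\
  (let nu : 'rV[R]_4 := \row_(i < 4) [:: 1; 1; -1; -1]`_i in
   exists P Q : @kostant R 3 nu, dict_le (Psi P) (Psi Q) /\ ~ merge_le P Q).
Proof.
split; last exact: dict_le_not_merge_le.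
move=> n nu _; split; first exact: Psi_bij.
move=> P Q; elim=> {P Q} [P Q /merge1_dict_lt|P|P Q T _ [->|PQ] _ [<-|QT]];
  rewrite /dict_le; auto.
by right; apply: dict_lt_trans QT.
Qed.
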